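(* There is an algorithm solving the $(\epsilon,\delta)$-winner determination problem for the plurality with runoff voting rule with sample complexity $O\!\left(\frac{\log(1/\delta)}{\epsilon^2}\right)$.
   Context: An election has $n$ voters and $m$ candidates, each vote a complete linear order. The plurality score of a candidate is the number of votes ranking it first. Under plurality with runoff, the two candidates with the highest plurality scores advance, and the pairwise majority winner between them wins (ties broken by an arbitrary fixed rule). The margin of victory (MOV) is the smallest number of votes that must be changed (others kept unchanged) to change the winner. The $(\epsilon,\delta)$-winner determination problem: given the $n$ votes with MOV at least $\epsilon n$, output the winner with probability at least $1-\delta$ over the algorithm's internal randomness; the algorithm may query full votes of arbitrary voters, and the sample complexity is the number of queried votes. *)

(* Defs.v *)
From HB Require Import structures.
From mathcomp Require Import all_boot all_order all_algebra all_fingroup.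
From mathcomp Require Import all_classical all_reals all_analysis.

Set Implicit Arguments.
Unset Strict Implicit.
Unset Printing Implicit Defensive.

Import Order.TTheory GRing.Theory Num.Theory.

Local Open Scope ring_scope.

(* A vote is encoded by its rank function: [v c] is the position of candidate
   [c] in the vote [v], position 0 being the top. *)
Notation vote m := {perm 'I_m}.
Notation profile n m := {ffun 'I_n -> vote m}.

Section PluralityRunoff.

Variables n m : nat.
Implicit Types (P Q : profile n m) (a b c w l : 'I_m) (r : profile n m -> 'I_m).

Definition plurality_score P c : nat := #|[set i | P i c == 0 :> nat]|.

Definition pairwise_support P a b : nat := #|[set i | (P i a < P i b)%N]|.

Definition finalists P a b : bool :=
  (a != b) &&
  [forall c, (c != a) && (c != b) ==>
     (plurality_score P c <= minn (plurality_score P a) (plurality_score P b))%N].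

(* Ties are left open here: [w] wins under at least one way of breaking the
   ties for the two runoff places and in the runoff itself. *)
Definition possible_winner P w : bool :=
  [exists l, finalists P w l && (pairwise_support P l w <= pairwise_support P w l)%N].

(* Plurality with runoff under an arbitrary fixed tie-breaking rule: any
   function selecting one of the tie-breaking outcomes at every profile. *)
Definition plurality_runoff_rule r : Prop := forall P, possible_winner P (r P).

Definition votes_changed P Q : nat := #|[set i | P i != Q i]|.

(* [n] is only the unit of the iterated minimum: at most [n] votes can be
   changed, and by [margin_of_victory_attained] the range is never empty when
   there are a voter and two candidates. *)
Definition margin_of_victory r P : nat :=
  \big[minn/n]_(Q : profile n m | r Q != r P) votes_changed P Q.

Lemma votes_changed_le P Q : (votes_changed P Q <= n)%N.
Proof. by rewrite -[X in (_ <= X)%N]card_ord max_card. Qed.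

Lemma unanimous_winner r (v : vote m) c :
  (0 < n)%N -> plurality_runoff_rule r -> v c = 0%N :> nat ->
  r [ffun=> v] = c.
Proof.
move=> n0 hr vc; set Q : profile n m := [ffun=> v].
have first d : d != c -> (0 < v d)%N.
  move=> dc; rewrite lt0n; apply: contra dc => /eqP vd.
  by apply/eqP/(@perm_inj _ v)/val_inj; rewrite /= vd vc.
have scT : plurality_score Q c = n.
  rewrite /plurality_score -[RHS]card_ord -cardsT; apply: eq_card => i.
  by rewrite !inE ffunE vc.
have sc0 d : d != c -> plurality_score Q d = 0%N.
  move=> /first; rewrite lt0n => /negbTE vd; apply: eq_card0 => i.
  by rewrite !inE ffunE vd.
apply/eqP; apply: contraT => wc.
have /existsP[l /andP[/andP[wl /forallP fin] sup]] := hr Q.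
have [lc|lc] := eqVneq l c; last first.
  have := fin c; rewrite eq_sym wc eq_sym lc /= scT sc0 // min0n leqn0.
  by move=> /eqP n00; rewrite n00 in n0.
have sT : pairwise_support Q l (r Q) = n.
  rewrite /pairwise_support -[RHS]card_ord -cardsT; apply: eq_card => i.
  by rewrite !inE ffunE lc vc first.
have s0 : pairwise_support Q (r Q) l = 0%N.
  by apply: eq_card0 => i; rewrite !inE ffunE lc vc ltn0.
by move: sup; rewrite sT s0 leqNgt n0.
Qed.

Lemma margin_of_victory_attained r P :
  (0 < n)%N -> (1 < m)%N -> plurality_runoff_rule r ->
  exists2 Q, r Q != r P & margin_of_victory r P = votes_changed P Q.
Proof.
move=> n0 m1 hr; have m0 : (0 < m)%N by exact: ltnW.
pose z : 'I_m := Ordinal m0; pose o : 'I_m := Ordinal m1.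
pose d := if r P == z then o else z.
have dP : d != r P.
  by rewrite /d; case: ifPn => [/eqP->|]; rewrite // eq_sym.
pose Q0 : profile n m := [ffun=> tperm d z].
have hQ0 : r Q0 != r P by rewrite (@unanimous_winner r _ d) //= tpermL.
have [Q hQ minQ] := @arg_minnP _ Q0 (fun Q => r Q != r P) (votes_changed P) hQ0.
exists Q => //; apply/eqP; rewrite eqn_leq; apply/andP; split.
  rewrite /margin_of_victory; have: Q \in index_enum _ by exact: mem_index_enum.
  elim: (index_enum _) => // x s IH; rewrite inE big_cons.
  move=> /predU1P[<-|/IH le_s]; first by rewrite hQ geq_minl.
  by case: ifP => // _; rewrite geq_min le_s orbT.
rewrite /margin_of_victory; apply: (big_ind (fun k => votes_changed P Q <= k)%N).
- exact: votes_changed_le.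
- by move=> x y hx hy; rewrite leq_min hx.
- by move=> Q' /minQ.
Qed.

End PluralityRunoff.

(* Adaptive deterministic algorithm: each query reveals one voter's full vote. *)
Inductive query_tree (n m : nat) : Type :=
| Output of 'I_m
| Query of 'I_n & (vote m -> query_tree n m).

Fixpoint run n m (t : query_tree n m) (P : profile n m) : 'I_m :=
  match t with
  | Output c => c
  | Query i k => run (k (P i)) P
  end.

Fixpoint num_queries n m (t : query_tree n m) (P : profile n m) : nat :=
  match t with
  | Output _ => 0
  | Query i k => (num_queries (k (P i)) P).+1
  end.

(* The internal randomness is a seed drawn uniformly from a nonempty finite
   set, independently of the votes. *)
Record randomized_algorithm (n m : nat) := RandomizedAlgorithm {
  seed : finType;
  seed_gt0 : (0 < #|seed|)%N;
  tree : seed -> query_tree n m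
}.

Definition output_prob (R : realType) n m (A : randomized_algorithm n m)
    (P : profile n m) (c : 'I_m) : R :=
  #|[set s : seed A | run (tree s) P == c]|%:R / #|seed A|%:R.

(* Worst case over the votes and the internal randomness. *)
Definition sample_complexity n m (A : randomized_algorithm n m) : nat :=
  \max_(s : seed A) \max_(P : profile n m) num_queries (tree s) P.

Definition solves_winner_determination (R : realType) n m
    (r : profile n m -> 'I_m) (eps delta : R)
    (A : randomized_algorithm n m) : Prop :=
  forall P : profile n m, eps * n%:R <= (margin_of_victory r P)%:R ->
    1 - delta <= output_prob R A P (r P).

(* Main.v *)
(* If the margin of victory is at least [eps * n], then in every pair of
   candidates that are finalists up to an error [eps * n / 4] in the plurality
   scores, the winner occurs and wins the pairwise comparison by a margin of order
   [eps * n]: otherwise fewer than [eps * n] changed votes would unseat it. For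
   [n <= 4 / eps], where rounding spoils this, all the votes are read.

   So it suffices to estimate all plurality scores and one pairwise comparison
   within [eps * n / 8]. The events "candidate [c] is on top" are disjoint, hence
   the sum over [c] of the squared errors has mean at most [1 / N] for [N] draws
   with replacement, and Chebyshev's inequality bounds all the errors at once with
   [N] of order [1 / eps ^ 2], without a union bound over the candidates. A second
   sample then decides the runoff between the two leaders of the first one. The
   two together fail with probability at most [1 / 16]; the majority of [k]
   independent repetitions fails with probability at most [2 ^- k]. *)
Require Import Defs.
From HB Require Import structures.
From mathcomp Require Import all_boot all_order all_algebra all_fingroup.
From mathcomp Require Import all_classical all_reals all_analysis.
(* fintype and finset once more: classical_sets shadows their lemma names. *)
From mathcomp Require Import fintype finset zify ring lra.

Set Implicit Arguments.
Unset Strict Implicit.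
Unset Printing Implicit Defensive.

Import Order.TTheory GRing.Theory Num.Theory.

Local Open Scope ring_scope.

(** * Upper bounds on the margin of victory from explicit changes of votes *)

Lemma subset_of_card (T : finType) (A : {set T}) (k : nat) :
  (k <= #|A|)%N -> exists2 B : {set T}, B \subset A & #|B| = k.
Proof.
move=> kA; exists [set x in take k (enum A)].
  by apply/subsetP => x; rewrite inE => /mem_take; rewrite mem_enum.
rewrite cardsE; have /card_uniqP -> : uniq (take k (enum A)).
  by rewrite take_uniq // enum_uniq.
by rewrite size_take -cardE; case: ltnP => // ?; apply/eqP; rewrite eqn_leq kA andbT.
Qed.

Section Manipulation.
Variables n m : nat.
Implicit Types (P Q : profile n m) (a b c w l : 'I_m) (T : {set 'I_n}).

Lemma top_vote_exists a : exists v : vote m, v a = 0%N :> nat.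
Proof.
pose z : 'I_m := Ordinal (leq_ltn_trans (leq0n a) (ltn_ord a)).
by exists (tperm a z); rewrite tpermL.
Qed.

Lemma top_unique (v : vote m) a b : v a = 0%N :> nat -> v b = 0%N :> nat -> a = b.
Proof. by move=> va vb; apply/(@perm_inj _ v)/val_inj; rewrite /= va vb. Qed.

Lemma pairwise_supportC P a b :
  a != b -> (pairwise_support P a b + pairwise_support P b a = n)%N.
Proof.
move=> ab; rewrite /pairwise_support -[RHS]card_ord -cardsT.
rewrite -cardsUI [X in (_ + X)%N](_ : _ = 0%N) ?addn0.
  apply: eq_card => i; rewrite !inE -neq_ltn.
  by apply: contra ab => /eqP/val_inj/perm_inj/eqP.
by apply: eq_card0 => i; rewrite !inE; case: ltngtP.
Qed.

Lemma margin_of_victory_le (r : profile n m -> 'I_m) P Q :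
  r Q != r P -> (margin_of_victory r P <= votes_changed P Q)%N.
Proof.
move=> hQ; rewrite /margin_of_victory.
have: Q \in index_enum _ by exact: mem_index_enum.
elim: (index_enum _) => // x s IH; rewrite inE big_cons.
move=> /predU1P[<-|/IH le_s]; first by rewrite hQ geq_minl.
by case: ifP => // _; rewrite geq_min le_s orbT.
Qed.

(** At most one candidate can beat a finalist in score, namely the other finalist. *)
Lemma not_winner_below_two (r : profile n m -> 'I_m) Q a b w :
  plurality_runoff_rule r -> a != b ->
  (plurality_score Q w < plurality_score Q a)%N ->
  (plurality_score Q w < plurality_score Q b)%N -> r Q != w.
Proof.
move=> hr ab wa wb; apply/eqP => rQ.
have /existsP[l /andP[/andP[wl /forallP fin] _]] := hr Q; rewrite rQ in wl fin.
have aw : a != w by apply: contraTneq wa => ->; rewrite ltnn.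
have bw : b != w by apply: contraTneq wb => ->; rewrite ltnn.
have := fin a; have := fin b; rewrite aw bw /= !leq_min.
rewrite [(plurality_score Q a <= _)%N]leqNgt wa [(plurality_score Q b <= _)%N]leqNgt wb /=.
by case: eqP => // <-; rewrite ab.
Qed.

Definition raise P T (v : vote m) : profile n m :=
  [ffun i => if i \in T then v else P i].

Lemma votes_changed_raise P T v : (votes_changed P (raise P T v) <= #|T|)%N.
Proof.
by apply/subset_leq_card/subsetP => i; rewrite inE ffunE; case: ifP; rewrite ?eqxx.
Qed.

Lemma raise_winner_score P T (v : vote m) a :
  v a = 0%N :> nat ->
  plurality_score (raise P T v) a = #|T :|: [set i | P i a == 0%N :> nat]|.
Proof.
move=> va; apply: eq_card => i; rewrite !inE ffunE.
by case: ifP; rewrite ?va ?eqxx.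
Qed.

Lemma raise_loser_score P T (v : vote m) a c :
  v a = 0%N :> nat -> c != a ->
  plurality_score (raise P T v) c = #|[set i | P i c == 0%N :> nat] :\: T|.
Proof.
move=> va ca; apply: eq_card => i; rewrite !inE ffunE.
by case: ifP => // _; apply/negbTE; apply: contra ca => /eqP vc; apply/eqP/(top_unique vc va).
Qed.

(* Put [a] on top of [M] votes preferring [b] (this turns the runoff) and of [M]
   votes not topped by [a] (this secures a runoff place): if [b] still gets into
   the runoff, it meets [a] there and loses. *)
Lemma margin_runoff_swing r P a b M :
  (0 < n)%N -> plurality_runoff_rule r -> a != b -> r P = b ->
  (forall c, c != a -> c != b ->
    (plurality_score P c < plurality_score P a + M)%N) ->
  (pairwise_support P b a < pairwise_support P a b + M.*2)%N ->
  (margin_of_victory r P <= M.*2)%N.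
Proof.
move=> n0 hr ab rP fin sup.
set S1 := [set i | (P i b < P i a)%N].
set A0 := [set i | P i a == 0%N :> nat].
(* With fewer than [M] votes preferring [b], all of them are taken; [b] then keeps no supporter, and
   [n0] makes the comparison strict. *)
have [T1 T1S cT1] := @subset_of_card _ S1 (minn M #|S1|) (geq_minr _ _).
have [T2 T2S cT2] := @subset_of_card _ (~: A0) (minn M #|~: A0|) (geq_minr _ _).
have [v va] := top_vote_exists a.
set T := T1 :|: T2; set Q := raise P T v.
have supQ : (pairwise_support Q b a < pairwise_support Q a b)%N.
  have : (pairwise_support Q b a <= #|S1| - #|T1|)%N.
    rewrite -(setIidPr T1S) -cardsD; apply/subset_leq_card/subsetP => i.
    rewrite !inE ffunE !inE; case: (i \in T1) => /=; first by rewrite va.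
    by case: (i \in T2) => //; rewrite va.
  have := pairwise_supportC P ab; have := pairwise_supportC Q ab.
  have : pairwise_support P b a = #|S1| by [].
  rewrite cT1; lia.
have scQ : (minn (plurality_score P a + M) n <= plurality_score Q a)%N.
  rewrite (raise_winner_score _ _ va) -/A0.
  have : (#|T2 :|: A0| <= #|T :|: A0|)%N by apply/subset_leq_card/setSU/subsetUr.
  rewrite cardsU (_ : T2 :&: A0 = set0) ?cards0; last first.
    by apply/eqP; rewrite setI_eq0 disjoints_subset.
  have := cardsC A0; rewrite card_ord -/(plurality_score P a).
  have : #|A0| = plurality_score P a by [].
  rewrite cT2; move: #|T :|: A0| #|A0| #|~: A0| (plurality_score P a) => x y z t. lia.
have rQ : r Q != r P.
  rewrite rP; apply/eqP => rQb.
  have /existsP[l /andP[/andP[bl /forallP finQ] supl]] := hr Q.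
  rewrite rQb in bl finQ supl.
  have [la|la] := eqVneq l a; first by rewrite la leqNgt supQ in supl.
  have := finQ a; rewrite ab eq_sym la /= leq_min => /andP[_ al].
  have := fin l la; rewrite eq_sym bl => /(_ isT).
  have le_l : (plurality_score Q l <= plurality_score P l)%N.
    by rewrite (raise_loser_score _ _ va la) subset_leq_card // subsetDl.
  (* This settles the case where the minimum in [scQ] is [n]: [a] then holds every first place and
     leaves none for [l]. *)
  have disj : (plurality_score Q a + plurality_score Q l <= n)%N.
    rewrite /plurality_score -cardsUI [X in (_ + X)%N](_ : _ = 0%N) ?addn0.
      by rewrite -[X in (_ <= X)%N]card_ord max_card.
    apply: eq_card0 => i; rewrite !inE; apply/negP => /andP[/eqP h /eqP h'].
    by move/eqP: la; apply; exact: top_unique h' h.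
  lia.
apply: leq_trans (margin_of_victory_le rQ) _.
apply: leq_trans (votes_changed_raise _ _ _) _.
by rewrite cardsU cT1 cT2; lia.
Qed.

(* A winner with at least [M] first places is pushed out of the runoff by giving
   [M] of them to [a]; one with fewer loses all of them, and two more changed
   votes ensure that [a] and [b] have a positive score. *)
Lemma margin_finalist_swap r P a b M :
  (1 < n)%N -> (0 < M)%N -> plurality_runoff_rule r ->
  a != b -> a != r P -> b != r P ->
  (plurality_score P (r P) < plurality_score P a + M)%N ->
  (plurality_score P (r P) < plurality_score P b + M)%N ->
  (margin_of_victory r P <= M.*2)%N.
Proof.
move=> n1 M0 hr ab aw bw scA scB; set w := r P in aw bw scA scB.
have [va hva] := top_vote_exists a; have [vb hvb] := top_vote_exists b.
set W := [set i | P i w == 0%N :> nat].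
have [MW|MW] := leqP M #|W|.
  have [T TW cT] := subset_of_card MW.
  apply: leq_trans (_ : (votes_changed P (raise P T va) <= _)%N); last first.
    by apply: leq_trans (votes_changed_raise _ _ _) _; rewrite cT; lia.
  apply: margin_of_victory_le; rewrite -/w.
  have sub_lt x : (plurality_score P w < x + M -> #|W| - M < x)%N.
    by move: MW; rewrite /plurality_score -/W; move: #|W| => y; lia.
  have scW : plurality_score (raise P T va) w = (#|W| - M)%N.
    rewrite (raise_loser_score _ _ hva) 1?eq_sym //.
    by rewrite cardsD (setIidPr TW) cT.
  apply: (@not_winner_below_two _ _ a b) => //; rewrite scW.
    apply: leq_trans (sub_lt _ scA) _; rewrite (raise_winner_score _ _ hva).
    by rewrite subset_leq_card // subsetUr.
  apply: leq_trans (sub_lt _ scB) _.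
  rewrite (raise_loser_score _ _ hva) 1?eq_sym //.
  rewrite (_ : _ :\: T = [set i | P i b == 0%N :> nat]) //.
  apply/setDidPl; rewrite disjoint_sym; apply: disjointWl TW _.
  rewrite disjoints_subset; apply/subsetP => i; rewrite !inE => /eqP wi.
  by apply: contra bw => /eqP bi; exact/eqP/(top_unique bi wi).
pose i0 : 'I_n := Ordinal (ltnW n1); pose j0 : 'I_n := Ordinal n1.
pose Q := [ffun i => if i == i0 then va else if i == j0 then vb
                     else if i \in W then va else P i] : profile n m.
have Qi0 : Q i0 = va by rewrite ffunE eqxx.
have Qj0 : Q j0 = vb by rewrite ffunE eqxx.
have scW : plurality_score Q w = 0%N.
  apply: eq_card0 => i; rewrite !inE ffunE !inE.
  have vaw : (va w == 0%N :> nat) = false.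
    by apply/negbTE; apply: contra aw => /eqP h; exact/eqP/(top_unique hva h).
  have vbw : (vb w == 0%N :> nat) = false.
    by apply/negbTE; apply: contra bw => /eqP h; exact/eqP/(top_unique hvb h).
  by case: ifP => // _; case: ifP => // _; case: ifP.
apply: leq_trans (_ : (votes_changed P Q <= _)%N).
  apply: margin_of_victory_le; rewrite -/w.
  apply: (@not_winner_below_two _ _ a b) => //; rewrite scW card_gt0.
    by apply/set0Pn; exists i0; rewrite inE Qi0 hva.
  by apply/set0Pn; exists j0; rewrite inE Qj0 hvb.
have : (votes_changed P Q <= #|[set i0; j0] :|: W|)%N.
  apply/subset_leq_card/subsetP => i; rewrite !inE ffunE !inE.
  by do 3?[case: ifP => //]; rewrite eqxx.
(* Since [#|W| < M], at most [M + 1] votes change, and [M + 1 <= M.*2] because [0 < M]. *)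
rewrite cardsU cards2; move: MW; move: #|W| => x MW; lia.
Qed.

(** Two cases are left for the winner: it is [b], and the runoff is swung; or it lies outside the
    pair, exceeds neither score of the pair by [M] or more, and can be pushed out. *)
Lemma margin_approximate_runoff r P a b M :
  (1 < n)%N -> (0 < M)%N -> plurality_runoff_rule r ->
  a != b -> a != r P ->
  (forall c, c != a -> c != b ->
    (plurality_score P c <
       minn (plurality_score P a) (plurality_score P b) + M)%N) ->
  (pairwise_support P b a < pairwise_support P a b + M.*2)%N ->
  (margin_of_victory r P <= M.*2)%N.
Proof.
move=> n1 M0 hr ab aw fin sup; have [bw|bw] := eqVneq b (r P).
  apply: (@margin_runoff_swing _ _ a b) => //; first exact: ltnW.
  by move=> c ca cb; have := fin c ca cb; lia.
apply: (@margin_finalist_swap _ _ a b) => //.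
  by have := fin (r P); rewrite eq_sym aw eq_sym bw => /(_ isT isT); lia.
by have := fin (r P); rewrite eq_sym aw eq_sym bw => /(_ isT isT); lia.
Qed.

End Manipulation.

(** * Sampling with replacement: second moments, deviation bound, majority amplification *)

Lemma sum_ffun_eval (R : comPzRingType) (N : nat) (X : finType) (u : X -> R) (j : 'I_N) :
  (\sum_(f : {ffun 'I_N -> X}) u (f j)) * #|X|%:R = #|X|%:R ^+ N * \sum_x u x.
Proof.
pose G (i : 'I_N) x := if i == j then u x else 1.
(* As a product over all coordinates with factor 1 off [j], the summand lets the sum over [f]
   factor; the extra [#|X|] in the statement avoids the exponent [N.-1]. *)
rewrite (eq_bigr (fun f : {ffun 'I_N -> X} => \prod_i G i (f i))); last first.
  move=> f _; rewrite (bigD1 j) //= /G eqxx big1 ?mulr1 // => i; case: (i == j) => //.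
rewrite -(bigA_distr_bigA G) (bigD1 j) //= /G eqxx.
rewrite [\prod_(i | i != j) _](eq_bigr (fun=> #|X|%:R)); last first.
  by move=> i ij; rewrite (negbTE ij) sumr_const.
rewrite prodr_const cardC1 card_ord -mulrA -exprSr.
by rewrite (ltn_predK (ltn_ord j)) mulrC.
Qed.

(** Distinct coordinates of a uniform [f] are independent, so the cross terms of a centred [h]
    vanish. *)
Lemma sum_ffun_eval2 (R : comPzRingType) (N : nat) (X : finType) (h : X -> R) (j j' : 'I_N) :
  j != j' -> \sum_x h x = 0 ->
  \sum_(f : {ffun 'I_N -> X}) h (f j) * h (f j') = 0.
Proof.
move=> jj' h0; pose G (i : 'I_N) x := if (i == j) || (i == j') then h x else 1.
rewrite (eq_bigr (fun f : {ffun 'I_N -> X} => \prod_i G i (f i))); last first.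
  move=> f _; rewrite (bigD1 j) //= (bigD1 j') 1?eq_sym //= /G !eqxx orbT.
  by rewrite big1 ?mulr1 // => i /andP[/negbTE -> /negbTE ->].
rewrite -(bigA_distr_bigA G) (bigD1 j) //= [X in X * _](_ : _ = 0) ?mul0r //.
by rewrite /G eqxx.
Qed.

Lemma sum_ffun_sqr (R : comPzRingType) (N : nat) (X : finType) (h : X -> R) :
  \sum_x h x = 0 ->
  (\sum_(f : {ffun 'I_N -> X}) (\sum_j h (f j)) ^+ 2) * #|X|%:R =
  N%:R * #|X|%:R ^+ N * \sum_x h x ^+ 2.
Proof.
move=> h0; under eq_bigr do rewrite expr2 big_distrlr /=.
rewrite exchange_big /= mulr_suml.
rewrite (eq_bigr (fun=> #|X|%:R ^+ N * \sum_x h x ^+ 2)); last first.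
  move=> j _; rewrite exchange_big /= (bigD1 j) //= [X in _ + X]big1 ?addr0.
    by rewrite -(sum_ffun_eval (fun x => h x ^+ 2) j).
  by move=> j'; rewrite eq_sym => jj'; exact: sum_ffun_eval2.
by rewrite sumr_const card_ord -[LHS]mulr_natl mulrA.
Qed.

Section SamplingDeviation.
Variables (R : realFieldType) (X Y : finType) (N : nat) (E : Y -> pred X).
Hypothesis E_disjoint : forall x, (\sum_y E y x <= 1)%N.

Let s y := #|[set x | E y x]|.
Let k (f : {ffun 'I_N -> X}) y := #|[set j | E y (f j)]|.

(* The variances of all the counts add up to at most [N], however many events
   there are: this is why the sample size does not depend on the number of
   candidates. *)
Lemma sum_sampling_variance : (0 < #|X|)%N ->
  \sum_f \sum_y ((k f y)%:R - N%:R * ((s y)%:R / #|X|%:R)) ^+ 2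
    <= N%:R * #|X|%:R ^+ N :> R.
Proof.
move=> X0; have X0R : 0 < #|X|%:R :> R by rewrite ltr0n.
pose p y : R := (s y)%:R / #|X|%:R.
pose h y x : R := (E y x)%:R - p y.
have sE y : \sum_x (E y x)%:R = (s y)%:R :> R.
  rewrite -natr_sum /s -sum1_card [in RHS]big_mkcond /=; congr (_%:R).
  by apply: eq_bigr => x _; rewrite inE; case: (E y x).
have hE f y : (k f y)%:R - N%:R * p y = \sum_j h y (f j).
  rewrite /h big_split /= sumrN sumr_const card_ord mulr_natl; congr (_ - _).
  rewrite -natr_sum /k -sum1_card [in LHS]big_mkcond /=; congr (_%:R).
  by apply: eq_bigr => x _; rewrite inE; case: (E y _).
have pX y : p y * #|X|%:R = (s y)%:R by rewrite /p divfK // gt_eqF.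
have h0 y : \sum_x h y x = 0.
  by rewrite /h big_split /= sumrN sumr_const sE -pX mulr_natr subrr.
have h2 y : \sum_x h y x ^+ 2 <= (s y)%:R.
  (* Indicators are idempotent, so the summands of the two sides differ by [- p y * h y x], which
     sums to zero. *)
  have -> : \sum_x h y x ^+ 2 = (s y)%:R - p y * (s y)%:R.
    rewrite -sE mulr_sumr -sumrB; apply/eqP; rewrite -subr_eq0 -sumrB.
    rewrite (eq_bigr (fun x => - p y * h y x)).
      by rewrite -mulr_sumr h0 mulr0.
    by move=> x _; rewrite /h; case: (E y x) => /=; ring.
  by rewrite gerBl mulr_ge0 // divr_ge0.
rewrite exchange_big /= -(ler_pM2r X0R) mulr_suml.
under eq_bigr do (under eq_bigr do rewrite hE); under eq_bigr do rewrite sum_ffun_sqr //.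
rewrite -mulr_sumr ler_wpM2l ?mulr_ge0 ?exprn_ge0 //.
apply: le_trans (ler_sum _ (fun y _ => h2 y)) _.
(* Double counting: each [x] lies in at most one event, so the [s y] add up to at most [#|X|]. *)
under eq_bigr do rewrite -sE; rewrite exchange_big /=.
rewrite -sum1_card natr_sum; apply: ler_sum => x _.
by rewrite -natr_sum ler_nat.
Qed.

(** Chebyshev: each bad [f] contributes at least [(N * (eps / 8)) ^ 2] to a total of at most
    [N * #|X| ^ N]; the threshold is [2048 = 32 * 64]. *)
Lemma sampling_deviation (eps : R) : (0 < #|X|)%N -> 0 < eps ->
  2048 <= N%:R * eps ^+ 2 ->
  (32 * #|[set f | [exists y,
     (eps / 8 <= `|(k f y)%:R / N%:R - (s y)%:R / #|X|%:R| :> R)%R]]|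
    <= #|X| ^ N)%N.
Proof.
move=> X0 eps0 Neps; set B := [set f | _].
have N0 : 0 < N%:R :> R.
  by rewrite ltr0n lt0n; apply: contraTneq Neps => ->; rewrite mul0r lern0.
set t : R := (N%:R * (eps / 8)) ^+ 2.
have : #|B|%:R * t <= N%:R * #|X|%:R ^+ N.
  apply: le_trans (sum_sampling_variance X0).
  rewrite mulr_natl -sumr_const [leRHS](bigID (mem B)) /= -[leLHS]addr0.
  apply: lerD; last first.
    by apply: sumr_ge0 => f _; apply: sumr_ge0 => y _; exact: sqr_ge0.
  apply: ler_sum => f; rewrite inE => /existsP[y hy].
  rewrite (bigD1 y) //= -[leLHS]addr0; apply: lerD; last first.
    by apply: sumr_ge0 => z _; exact: sqr_ge0.
  rewrite -[leRHS]real_normK ?num_real // /t ler_sqr ?nnegrE ?normr_ge0 //; last first.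
    by rewrite mulr_ge0 ?divr_ge0 // ltW.
  rewrite -[leLHS]/(_ * _) [(k f y)%:R](_ : _ = N%:R * ((k f y)%:R / N%:R)).
    by rewrite -mulrBr normrM (gtr0_norm N0) ler_pM2l.
  by rewrite mulrC divfK // gt_eqF.
rewrite -(ler_nat R) natrM natrX /t => h.
have h2 : #|B|%:R * N%:R * eps ^+ 2 <= 64 * #|X|%:R ^+ N.
  rewrite -(ler_pM2l N0); nra.
have := ler_wpM2l (ler0n R #|B|) Neps; nra.
Qed.

End SamplingDeviation.

(* Markov's inequality for [16 ^ #|[set j | f j \in B]|], whose mean is at most
   [2 ^ k], while it is at least [4 ^ k] when half of the draws fall in [B]. *)
Lemma majority_amplification (S : finType) (B : {set S}) (k : nat) :
  (16 * #|B| <= #|S|)%N ->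
  (#|[set f : {ffun 'I_k -> S} | k <= 2 * #|[set j | f j \in B]|]| * 2 ^ k
     <= #|S| ^ k)%N.
Proof.
move=> BS; set bad := [set f | _].
pose wt x := if x \in B then 16%N else 1%N.
have wtE (f : {ffun 'I_k -> S}) : (\prod_j wt (f j) = 16 ^ #|[set j | f j \in B]|)%N.
  rewrite -prod_nat_const [RHS]big_mkcond /=; apply: eq_bigr => j _.
  by rewrite inE.
have sum_wt : (\sum_x wt x <= 2 * #|S|)%N.
  rewrite (bigID (mem B)) /= (eq_bigr (fun=> 16%N)); last by move=> x; rewrite /wt => ->.
  rewrite sum_nat_const [X in (_ + X)%N](eq_bigr (fun=> 1%N)); last first.
    by move=> x /negbTE; rewrite /wt => ->.
  rewrite sum1_card mulnC mul2n -addnn leq_add ?max_card //.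
have : (#|bad| * 4 ^ k <= (2 * #|S|) ^ k)%N.
  apply: leq_trans (_ : \sum_(f : {ffun 'I_k -> S}) \prod_j wt (f j) <= _)%N.
    rewrite -sum_nat_const [leqRHS](bigID (mem bad)) /=.
    apply: leq_trans (leq_addr _ _); apply: leq_sum => f.
    rewrite inE wtE => kf; rewrite (_ : 16 = 4 ^ 2)%N // -expnM.
    exact: leq_pexp2l.
  rewrite -(bigA_distr_bigA (fun=> wt)) prod_nat_const card_ord.
  by case: (k) => // k'; rewrite leq_exp2r.
rewrite expnMn -[4%N]/(2 * 2)%N expnMn mulnA mulnC leq_pmul2l ?expn_gt0 //.
Qed.

(** * Nonadaptive querying as a decision tree *)

Section NonadaptiveQueries.
Variables (n m : nat) (T : finType) (idx : T -> 'I_n).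
Variable dec : (T -> vote m) -> 'I_m.

(** Queries carry labels in [T] because draws with replacement may hit a voter twice; each draw then
    counts as a query. [ans] accumulates the answers. *)
Fixpoint query_seq (ts : seq T) (ans : T -> vote m) : query_tree n m :=
  match ts with
  | [::] => @Output n m (dec ans)
  | t :: ts' =>
      Query (idx t) (fun v => query_seq ts' (fun t' => if t' == t then v else ans t'))
  end.

Lemma run_query_seq ts ans P :
  run (query_seq ts ans) P = dec (fun t => if t \in ts then P (idx t) else ans t).
Proof.
elim: ts ans => [|t ts IH] ans //=; rewrite IH; congr dec.
apply/funext => t'; rewrite inE.
by case: (t' \in ts) => /=; rewrite ?orbT ?orbF //; case: eqP => // ->.
Qed.

Lemma num_queries_query_seq ts ans P : num_queries (query_seq ts ans) P = size ts.
Proof. by elim: ts ans => [|t ts IH] ans //=; rewrite IH. Qed.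

(** The identity vote is only an initial value: [enum T] contains every label, so all of them get
    overwritten. *)
Definition query_all : query_tree n m := query_seq (enum T) (fun=> 1%g).

Lemma run_query_all P : run query_all P = dec (fun t => P (idx t)).
Proof.
by rewrite run_query_seq; congr dec; apply/funext => t; rewrite mem_enum.
Qed.

Lemma num_queries_query_all P : num_queries query_all P = #|T|.
Proof. by rewrite num_queries_query_seq -cardE. Qed.

End NonadaptiveQueries.

(** * The two-phase estimate and its accuracy *)

Section TwoPhaseEstimate.
Variables (m N : nat) (c0 : 'I_m).
Implicit Types (S : profile N m) (a b c : 'I_m).

Lemma finalistsC n (P : profile n m) a b : finalists P a b = finalists P b a.
Proof.
rewrite /finalists eq_sym; congr (_ && _); apply: eq_forallb => c.
by rewrite andbC minnC.
Qed.

Lemma finalists_exist n (P : profile n m) :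
  (1 < m)%N -> exists p, finalists P p.1 p.2.
Proof.
move=> m1; pose z : 'I_m := Ordinal (ltnW m1); pose o : 'I_m := Ordinal m1.
have [a _ maxa] := @arg_maxnP _ z xpredT (plurality_score P) isT.
have [d da] : exists d, d != a.
  by have [<-|] := eqVneq z a; [exists o | exists z].
have [b ba maxb] := @arg_maxnP _ d (fun c => c != a) (plurality_score P) da.
exists (a, b); rewrite /finalists /= eq_sym ba.
apply/forallP => c; apply/implyP => /andP[ca cb]; rewrite leq_min.
by apply/andP; split; [exact: maxa | exact: maxb].
Qed.

(** Ties in the sample are broken by [pick], with no relation to the rule [r]; [sample_finalistsP]
    excludes the default when [1 < m]. *)
Definition sample_finalists S : 'I_m * 'I_m :=
  odflt (c0, c0) [pick p | finalists S p.1 p.2].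

Lemma sample_finalistsP S :
  (1 < m)%N -> finalists S (sample_finalists S).1 (sample_finalists S).2.
Proof.
move=> m1; rewrite /sample_finalists; case: pickP => //= none.
by have [p] := finalists_exist S m1; rewrite none.
Qed.

(* The runoff is decided on a fresh sample, so only one pairwise comparison has
   to be estimated accurately instead of one for each of the pairs of candidates. *)
Definition two_phase_winner S1 S2 : 'I_m :=
  let p := sample_finalists S1 in
  if (pairwise_support S2 p.2 p.1 <= pairwise_support S2 p.1 p.2)%N
  then p.1 else p.2.

End TwoPhaseEstimate.

Lemma card_pair_dep (F G : finType) (B : F -> {set G}) :
  #|[set s : F * G | s.2 \in B s.1]| = (\sum_f #|B f|)%N.
Proof.
rewrite -sum1_card; under [RHS]eq_bigr do rewrite -sum1_card.
by rewrite pair_big_dep /=; apply: eq_bigl => s; rewrite inE.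
Qed.

Section Accuracy.
Variables (R : realType) (n m N : nat) (r : profile n m -> 'I_m) (eps : R).
Variable P : profile n m.
Hypothesis rule : plurality_runoff_rule r.
Hypothesis eps_le1 : eps <= 1.
Hypothesis N_gt0 : (0 < N)%N.
Hypothesis large : 4 < eps * n%:R.
Hypothesis margin : eps * n%:R <= (margin_of_victory r P)%:R.

(** Comparing two scores adds two errors, so [eps / 8] guarantees the order of the true scores up to
    [eps / 4]. *)
Definition close (x y : nat) : Prop := `|x%:R / N%:R - y%:R / n%:R| < eps / 8.

Let n_gt1 : (1 < n)%N.
Proof.
rewrite -(ltr_nat R); apply: lt_le_trans (_ : eps * n%:R <= _).
  by apply: lt_trans large; rewrite ltr_nat.
by rewrite ler_piMl.
Qed.

Let n0R : 0 < n%:R :> R. Proof. by rewrite ltr0n ltnW. Qed.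
Let N0R : 0 < N%:R :> R. Proof. by rewrite ltr0n. Qed.

(** The sample finalists are finalists of [P] up to about [eps * n / 4], so
    [margin_approximate_runoff] would contradict the margin if [a] were not the winner. *)
Lemma close_runoff_winner (S1 S2 : profile N m) a b :
  (forall c, close (plurality_score S1 c) (plurality_score P c)) ->
  close (pairwise_support S2 a b) (pairwise_support P a b) ->
  finalists S1 a b -> (pairwise_support S2 b a <= pairwise_support S2 a b)%N ->
  a = r P.
Proof.
move=> hsc hsup /andP[ab /forallP fin] sup; apply/eqP/contraT => aw.
(* Rounding up costs at most 1, so [M.*2] is at most [eps * n / 2 + 2], which is below [eps * n]
   exactly because [4 < eps * n]. *)
pose M := (Num.truncn (eps * n%:R / 4)).+1.
have MR : eps * n%:R / 4 < M%:R by exact: truncnS_gt.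
have MR' : M%:R <= eps * n%:R / 4 + 1.
  rewrite /M -natr1 lerD2r truncn_le; have := large; lra.
suff : (margin_of_victory r P <= M.*2)%N.
  rewrite -(ler_nat R) -muln2 natrM => hM.
  have := le_trans margin hM; have := large; lra.
have score_lt c d : (plurality_score S1 c <= plurality_score S1 d)%N ->
    (plurality_score P c < plurality_score P d + M)%N.
  rewrite -(ler_nat R) -(ltr_nat R) natrD => cd.
  have cdN : (plurality_score S1 c)%:R / N%:R <= (plurality_score S1 d)%:R / N%:R :> R.
    by rewrite ler_pM2r ?invr_gt0.
  have := hsc c; have := hsc d; rewrite /close !ltr_norml => /andP[_ hd] /andP[hc _].
  have : (plurality_score P c)%:R / n%:R < (plurality_score P d)%:R / n%:R + eps / 4 :> R.
    by lra.
  rewrite ltr_pdivrMr // mulrDl divfK ?gt_eqF // => h.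
  by move: h MR; rewrite mulrAC; lra.
apply: (@margin_approximate_runoff _ _ r P a b) => //.
  move=> c ca cb; have := fin c; rewrite ca cb /= leq_min => /andP[h1 h2].
  by rewrite addn_minl leq_min !score_lt.
have sP := pairwise_supportC P ab; have sS := pairwise_supportC S2 ab.
(* [a] has at least half of the second sample, so its deficit against [b] in [P] is below
   [eps * n / 4], hence below [M.*2]. *)
have half : 2^-1 <= (pairwise_support S2 a b)%:R / N%:R :> R.
  by rewrite (ler_pdivlMr _ _ N0R) ler_pdivrMl // -natrM ler_nat; lia.
move: hsup; rewrite /close ltr_norml => /andP[_ h].
have : 2^-1 - eps / 8 < (pairwise_support P a b)%:R / n%:R by lra.
rewrite ltr_pdivlMr // => h2.
rewrite -(ltr_nat R) natrD -muln2 natrM.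
have -> : (pairwise_support P b a)%:R = n%:R - (pairwise_support P a b)%:R :> R.
  by rewrite -[in n%:R]sP natrD; ring.
move: h2 MR large; lra.
Qed.

Lemma close_sym (S2 : profile N m) a b : a != b ->
  close (pairwise_support S2 a b) (pairwise_support P a b) ->
  close (pairwise_support S2 b a) (pairwise_support P b a).
Proof.
move=> ab; rewrite /close.
have -> : (pairwise_support S2 b a)%:R = N%:R - (pairwise_support S2 a b)%:R :> R.
  by rewrite -[in N%:R](pairwise_supportC S2 ab) natrD; ring.
have -> : (pairwise_support P b a)%:R = n%:R - (pairwise_support P a b)%:R :> R.
  by rewrite -[in n%:R](pairwise_supportC P ab) natrD; ring.
rewrite !mulrBl !divff ?gt_eqF // => h.
by rewrite -normrN; move: h; congr (`|_| < _); ring.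
Qed.

Lemma two_phase_winner_correct (c0 : 'I_m) (S1 S2 : profile N m) :
  (1 < m)%N ->
  (forall c, close (plurality_score S1 c) (plurality_score P c)) ->
  (let p := sample_finalists c0 S1 in
   close (pairwise_support S2 p.1 p.2) (pairwise_support P p.1 p.2)) ->
  two_phase_winner c0 S1 S2 = r P.
Proof.
move=> m1 hsc hsup; have fin := sample_finalistsP c0 S1 m1.
rewrite /two_phase_winner /=; case: leqP => [sup|/ltnW sup].
  exact: close_runoff_winner fin sup.
apply: close_runoff_winner sup => //; last by rewrite finalistsC.
by apply: close_sym => //; case/andP: fin.
Qed.

Definition resample (f : {ffun 'I_N -> 'I_n}) : profile N m := [ffun j => P (f j)].

(** Each phase fails with probability at most [1 / 32]. The pair compared in the second depends on
    the first sample alone, so the bound for a fixed pair is applied for each [f] and summed. *)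
Lemma two_phase_failure (c0 : 'I_m) :
  (1 < m)%N -> 2048 <= N%:R * eps ^+ 2 ->
  (16 * #|[set s : {ffun 'I_N -> 'I_n} * {ffun 'I_N -> 'I_n} |
            two_phase_winner c0 (resample s.1) (resample s.2) != r P]|
    <= #|{: {ffun 'I_N -> 'I_n} * {ffun 'I_N -> 'I_n}}|)%N.
Proof.
move=> m1 hN; set Bd := [set s | _].
have eps0 : 0 < eps by rewrite -(pmulr_lgt0 _ n0R) (lt_trans _ large).
have n0 : (0 < #|'I_n|)%N by rewrite card_ord ltnW.
pose E1 (c : 'I_m) (i : 'I_n) := P i c == 0%N :> nat.
have E1d i : (\sum_c E1 c i <= 1)%N.
  case: (pickP (fun c => E1 c i)) => [c Ec|E0]; last by rewrite big1 // => c _; rewrite E0.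
  rewrite (bigD1 c) //= Ec big1 // => d dc; apply/eqP; rewrite eqb0.
  by apply: contra dc => /eqP di; apply/eqP/(top_unique di)/eqP.
(* Indexing by [unit] turns a single comparison into a one-member family, to which
   [sampling_deviation] applies. *)
pose E2 a b (_ : unit) (i : 'I_n) := (P i a < P i b)%N.
have E2d a b i : (\sum_u E2 a b u i <= 1)%N.
  by rewrite big_const card_unit /= addn0 leq_b1.
have dev1 := sampling_deviation E1d n0 eps0 hN.
have dev2 a b := sampling_deviation (E2d a b) n0 eps0 hN.
set B1 := [set f | _] in dev1.
pose B2 a b := [set f : {ffun 'I_N -> 'I_n} | [exists y, (eps / 8 <=
   `|#|[set j | E2 a b y (f j)]|%:R / N%:R - #|[set x | E2 a b y x]|%:R / #|'I_n|%:R|)%R]].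
pose sel f := sample_finalists c0 (resample f).
have sub : Bd \subset finset.setX B1 setT :|:
    [set s | s.2 \in B2 (sel s.1).1 (sel s.1).2].
  apply/subsetP => -[f1 f2]; rewrite !inE /= andbT; apply: contraR.
  rewrite negb_or !negb_exists => /andP[/forallP h1 /forallP/(_ tt) h2].
  apply/eqP/two_phase_winner_correct => // [c|].
    have := h1 c; rewrite -ltNge card_ord /close; congr (`|_%:R / _ - _| < _).
    by apply: eq_card => j; rewrite !inE ffunE.
  move: h2; rewrite -ltNge card_ord /close; congr (`|_%:R / _ - _| < _).
  by apply: eq_card => j; rewrite !inE !ffunE.
apply: leq_trans (_ : 16 * (#|B1| * #|{: {ffun 'I_N -> 'I_n}}| +
                            \sum_f #|B2 (sel f).1 (sel f).2|) <= _)%N.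
  rewrite leq_mul2l /= (leq_trans (subset_leq_card sub)) //.
  rewrite -(card_pair_dep (fun f => B2 (sel f).1 (sel f).2)) -cardsT -cardsX.
  by rewrite cardsU leq_subr.
have : (32 * \sum_f #|B2 (sel f).1 (sel f).2| <=
    #|{: {ffun 'I_N -> 'I_n}}| * #|{: {ffun 'I_N -> 'I_n}}|)%N.
  rewrite big_distrr /= -[X in (_ <= X * _)%N]sum1_card big_distrl /=.
  apply: leq_sum => f _; rewrite mul1n card_ffun [X in (_ ^ X)%N]card_ord.
  exact: dev2.
have : (32 * (#|B1| * #|{: {ffun 'I_N -> 'I_n}}|) <=
    #|{: {ffun 'I_N -> 'I_n}}| * #|{: {ffun 'I_N -> 'I_n}}|)%N.
  rewrite mulnA leq_mul2r card_ffun [X in (_ ^ X)%N]card_ord.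
  by apply/orP; right; exact: dev1.
move=> h1 h2; rewrite card_prod -(leq_pmul2l (isT : 0 < 2)%N) mulnA mulnDr.
by rewrite [leqRHS]mul2n -addnn leq_add.
Qed.

End Accuracy.

(** * The repeated algorithm, its parameters and its sample complexity *)

Lemma inv_le_expn2 (R : realType) (delta : R) : 0 < delta ->
  delta^-1 <= 2 ^+ (Num.truncn (2 * ln (1 / delta))).+1.
Proof.
move=> d0; rewrite div1r; set k := (Num.truncn _).+1.
have hk : ln delta^-1 <= k%:R * 2^-1.
  by rewrite ler_pdivlMr // mulrC; apply/ltW; exact: truncnS_gt.
rewrite -[leLHS]lnK ?posrE ?invr_gt0 //.
apply: le_trans (_ : expR (k%:R * 2^-1) <= _); first by rewrite ler_expR.
rewrite expRM_natl lerXn2r ?nnegrE ?expR_ge0 //.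
(* [expR (- 1 / 2) >= 1 - 1 / 2] yields [expR (1 / 2) <= 2]; hence the factor 2 before [ln] in the
   exponent. *)
have := expR_ge1Dx (- 2^-1 : R); rewrite expRN => h.
rewrite -[leRHS]invrK -[leLHS]invrK lef_pV2 ?posrE ?invr_gt0 ?expR_gt0 //.
by apply: le_trans h; lra.
Qed.

Section DeterministicAlgorithm.
Variables n m : nat.

Definition deterministic (t : query_tree n m) : randomized_algorithm n m :=
  @RandomizedAlgorithm n m unit (eq_leq (esym card_unit)) (fun=> t).

Lemma output_prob_deterministic (R : realType) t P c :
  run t P = c -> output_prob R (deterministic t) P c = 1.
Proof.
move=> tP; rewrite /output_prob (_ : [set s | _] = [set: unit]%SET).
  by rewrite cardsT /= card_unit divff.
by apply/setP => s; rewrite !inE /= tP eqxx.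
Qed.

Lemma sample_complexity_le (A : randomized_algorithm n m) q :
  (forall (s : seed A) P, num_queries (tree s) P = q) -> (sample_complexity A <= q)%N.
Proof.
by move=> hq; apply/bigmax_leqP => s _; apply/bigmax_leqP => P _; rewrite hq.
Qed.

End DeterministicAlgorithm.

Section RepeatedTwoPhase.
Variables (n m : nat) (c0 : 'I_m) (k N : nat).

Notation sample := {ffun 'I_N -> 'I_n}.
Notation index := ('I_k * (bool * 'I_N))%type.

Definition majority (out : 'I_k -> 'I_m) : 'I_m :=
  odflt c0 [pick w | k < 2 * #|[set j | out j == w]|]%N.

(** The hypothesis negates the bad event of [majority_amplification]: outputs other than [w] are too
    few for any of them to have a majority. *)
Lemma majority_eq out w : ~~ (k <= 2 * #|[set j | out j != w]|)%N -> majority out = w.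
Proof.
rewrite -ltnNge => few; rewrite /majority; case: pickP => [w' /= hw'|/(_ w)].
  apply/eqP; apply: contraLR few => w'w; rewrite -leqNgt (leq_trans (ltnW hw')) //.
  rewrite leq_mul2l /=; apply/subset_leq_card/subsetP => j; rewrite !inE.
  by move=> /eqP ->.
move: few; have -> : [set j | out j != w] = ~: [set j | out j == w].
  by apply/setP => j; rewrite !inE.
have := cardsC [set j | out j == w]; rewrite card_ord.
move: #|[set j | out j == w]| #|~: _| => x y /=; lia.
Qed.

(** A label names the repetition, the phase ([true] for the first sample) and the draw. *)
Definition repeated_index (s : {ffun 'I_k -> sample * sample}) (t : index) : 'I_n :=
  if t.2.1 then (s t.1).1 t.2.2 else (s t.1).2 t.2.2.

Definition repeated_output (u : index -> vote m) : 'I_m :=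
  majority (fun j => two_phase_winner c0 [ffun i => u (j, (true, i))]
                                         [ffun i => u (j, (false, i))]).

Lemma repeated_seed_gt0 : (0 < n)%N -> (0 < #|{: {ffun 'I_k -> sample * sample}}|)%N.
Proof.
by move=> n0; rewrite card_ffun expn_gt0 card_prod muln_gt0 card_ffun expn_gt0 !card_ord n0.
Qed.

Definition repeated_two_phase (n0 : (0 < n)%N) : randomized_algorithm n m :=
  RandomizedAlgorithm (repeated_seed_gt0 n0)
    (fun s => query_all (repeated_index s) repeated_output).

Lemma num_queries_repeated n0 (s : seed (repeated_two_phase n0)) P :
  num_queries (tree s) P = (k * (2 * N))%N.
Proof. by rewrite num_queries_query_all !card_prod card_bool !card_ord. Qed.

Lemma output_prob_repeated (R : realType) (r : profile n m -> 'I_m) (eps : R) n0 P :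
  (1 < m)%N -> plurality_runoff_rule r -> eps <= 1 -> (0 < N)%N ->
  4 < eps * n%:R -> eps * n%:R <= (margin_of_victory r P)%:R ->
  2048 <= N%:R * eps ^+ 2 ->
  1 - (2 ^+ k)^-1 <= output_prob R (repeated_two_phase n0) P (r P).
Proof.
move=> m1 hr eps1 N0 large margin hN; rewrite /output_prob.
set S := seed _; set G := [set s | _].
have S0 : (0 < #|S|)%N := seed_gt0 _.
have S0R : 0 < #|S|%:R :> R by rewrite ltr0n.
have := two_phase_failure hr eps1 N0 large margin c0 m1 hN.
set B := [set s | _] => /(majority_amplification k).
set Bad := [set f | _] => hBad.
(* A wrong final output forces at least half of the repetitions to be wrong. *)
have sub : ~: G \subset Bad.
  apply/subsetP => s; rewrite !inE; apply: contraR => few.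
  rewrite /= run_query_all; apply/eqP/majority_eq; apply: contra few => few.
  rewrite (leq_trans few) // leq_mul2l /=; apply/subset_leq_card/subsetP => j.
  rewrite !inE; apply: contra => /eqP <-; apply/eqP.
  by congr two_phase_winner; apply/ffunP => i; rewrite !ffunE.
have : (#|~: G| * 2 ^ k <= #|S|)%N.
  apply: leq_trans (_ : #|Bad| * 2 ^ k <= _)%N.
    by rewrite leq_mul2r subset_leq_card ?orbT.
  by rewrite [X in (_ <= X)%N]card_ffun card_ord.
rewrite -(ler_nat R) natrM natrX => h.
have -> : #|G|%:R = #|S|%:R - #|~: G|%:R :> R by rewrite -(cardsC G) natrD addrK.
rewrite mulrBl divff ?gt_eqF // lerD2l lerN2.
by rewrite ler_pdivrMr // mulrC ler_pdivlMr // exprn_gt0.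
Qed.

End RepeatedTwoPhase.

(** The hypotheses stand under the existential so that [theorem11] can choose an algorithm for all
    arguments. For [eps > 1] the margin forces [n = 0], where there is only one profile. *)
Lemma winner_determination_algorithm (R : realType) (n m : nat)
    (r : profile n m -> 'I_m) (eps delta : R) :
  exists A : randomized_algorithm n m,
    (1 < m)%N -> plurality_runoff_rule r -> 0 < eps -> 0 < delta < 1 ->
    solves_winner_determination r eps delta A /\
    (sample_complexity A)%:R <= 8196 * ((ln (1 / delta) + 1) / eps ^+ 2).
Proof.
(* Applying [r] supplies a candidate before anything is assumed on [m]. *)
pose c0 := r [ffun=> 1%g].
have hL : 0 < delta < 1 -> 0 <= ln (1 / delta).
  by case/andP => d0 d1; rewrite ln_ge0 // div1r invf_ge1 // ltW.
have [eps1|eps1] := ltP 1 eps.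
  exists (deterministic (@Output n m c0)) => m1 hr eps0 hd; split; last first.
    apply: le_trans (_ : 0 <= _); last first.
      apply: mulr_ge0; first exact: ler0n.
      by rewrite divr_ge0 ?exprn_ge0 ?(ltW eps0) // addr_ge0 ?hL.
    by rewrite lern0 -leqn0 sample_complexity_le.
  move=> P margin; rewrite output_prob_deterministic; last first.
    have n0 : n = 0%N.
      have mov : (margin_of_victory r P <= n)%N.
        rewrite /margin_of_victory; apply: (big_ind (fun x => x <= n)%N) => //.
          by move=> x y hx hy; rewrite geq_min hx.
        by move=> Q _; exact: votes_changed_le.
      apply/eqP; rewrite -(pnatr_eq0 R) eq_le ler0n andbT.
      have : eps * n%:R <= n%:R by apply: le_trans margin _; rewrite ler_nat.
      nra.
    rewrite /= /c0; congr r; apply/ffunP => i.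
    by exfalso; case: i => i; rewrite n0.
  by case/andP: hd => d0 _; rewrite gerBl ltW.
have [small|large] := leP (eps * n%:R) 4.
  exists (deterministic (query_all id (fun u : 'I_n -> vote m => r [ffun i => u i]))).
  move=> m1 hr eps0 hd; split.
    move=> P _; rewrite output_prob_deterministic.
      by case/andP: hd => d0 _; rewrite gerBl ltW.
    by rewrite run_query_all; congr r; apply/ffunP => i; rewrite ffunE.
  apply: le_trans (_ : n%:R <= _).
    rewrite ler_nat; apply: sample_complexity_le => s P.
    by rewrite num_queries_query_all card_ord.
  rewrite mulrA ler_pdivlMr ?exprn_gt0 //; have := hL hd.
  have : n%:R * eps ^+ 2 <= 4 by have := ler0n R n; nra.
  by lra.
have n0 : (0 < n)%N by rewrite lt0n; apply: contraTneq large => ->; rewrite mulr0; lra.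
pose N := (Num.truncn (2048 / eps ^+ 2)).+1.
pose k := (Num.truncn (2 * ln (1 / delta))).+1.
exists (repeated_two_phase c0 k N n0) => m1 hr eps0 hd.
have e2 : 0 < eps ^+ 2 by rewrite exprn_gt0.
split.
  move=> P margin; apply: le_trans (output_prob_repeated c0 k n0 m1 hr eps1 _ large margin _)
    => //.
    case/andP: hd => d0 _; rewrite lerD2l lerN2.
    rewrite -[leRHS]invrK lef_pV2 ?posrE ?invr_gt0 ?exprn_gt0 //; exact: inv_le_expn2.
  by rewrite -ler_pdivrMr //; apply/ltW; exact: truncnS_gt.
apply: le_trans (_ : (k * (2 * N))%:R <= _).
  by rewrite ler_nat; apply: sample_complexity_le => s P; exact: num_queries_repeated.
rewrite mulrA ler_pdivlMr // !natrM.
(* Rounding [N] up adds [eps ^+ 2 <= 1] to 2048. *)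
have hN : N%:R * eps ^+ 2 <= 2049.
  rewrite /N -[_.+1%:R]natr1.
  have : (Num.truncn (2048 / eps ^+ 2))%:R * eps ^+ 2 <= 2048.
    rewrite -ler_pdivlMr // truncn_le; apply: divr_ge0; [exact: ler0n | exact: ltW].
  have : eps ^+ 2 <= 1 by rewrite exprn_ile1 // ltW.
  by lra.
have hk : k%:R <= 2 * ln (1 / delta) + 1.
  by rewrite /k -[_.+1%:R]natr1 lerD2r truncn_le mulr_ge0 // hL.
have := hL hd => L0.
rewrite -mulrA -[2 * _ * _]mulrA.
(* The final constant is [8196 = 2 * 2 * 2049]: the factor before [ln], the two samples, and the
   bound [hN]. *)
apply: le_trans (_ : (2 * ln (1 / delta) + 1) * (2 * 2049) <= _); last by lra.
by apply: ler_pM => //; rewrite ?mulr_ge0 ?ler_wpM2l // ltW.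
Qed.

Unset Implicit Arguments.

Theorem theorem11 (R : realType) :
  exists A : forall (n m : nat) (r : profile n m -> 'I_m) (eps delta : R),
      randomized_algorithm n m,
    (forall (n m : nat) (r : profile n m -> 'I_m) (eps delta : R),
        (1 < m)%N -> plurality_runoff_rule r ->
        0 < eps -> 0 < delta < 1 ->
        solves_winner_determination r eps delta (A n m r eps delta)) /\
    (forall delta0 : R, 0 < delta0 < 1 ->
      exists2 C : R, 0 < C &
        forall (n m : nat) (r : profile n m -> 'I_m) (eps delta : R),
          (1 < m)%N -> plurality_runoff_rule r ->
          0 < eps -> 0 < delta <= delta0 ->
          (sample_complexity (A n m r eps delta))%:R
            <= C * (ln (1 / delta) / eps ^+ 2)).
Proof.
exists (fun n m r eps delta =>
  projT1 (cid (@winner_determination_algorithm R n m r eps delta))).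
split=> [n m r eps delta m1 hr eps0 hd | delta0 /andP[d00 d01]].
  by case: cid => A /= /(_ m1 hr eps0 hd)[].
have L0 : 0 < ln delta0^-1 by rewrite ln_gt0 // invf_gt1.
(* The additive 1 is absorbed: [ln (1 / delta)] is at least [ln delta0^-1], which is positive, so 1
   is at most their quotient. *)
exists (8196 * (1 + (ln delta0^-1)^-1)).
  by apply: mulr_gt0; [exact: ltr0Sn | rewrite addr_gt0 ?invr_gt0].
move=> n m r eps delta m1 hr eps0 /andP[d0 dd0].
case: cid => A /= /(_ m1 hr eps0); rewrite d0 (le_lt_trans dd0 d01).
case=> // _ hA; apply: le_trans hA _; rewrite -mulrA (ler_pM2l (ltr0Sn R 8195)).
rewrite !div1r mulrA ler_pM2r ?invr_gt0 ?exprn_gt0 // mulrDl mul1r lerD2l.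
rewrite ler_pdivlMl // mulr1 ler_ln ?posrE ?invr_gt0 //.
by rewrite lef_pV2 ?posrE.
Qed.
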